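(* For every integer $n>3$ there exists an even-regular closed XOR-magic graph of power $n$, and there exists an odd-regular open XOR-magic graph of power $n$.
   Context: All graphs are simple. For a vertex $x$ of a graph, $N(x)$ denotes the set of neighbours of $x$ (open neighbourhood) and $N[x]=N(x)\cup\{x\}$ (closed neighbourhood). A graph is $k$-regular if every vertex has exactly $k$ neighbours; it is odd-regular (even-regular) if it is $k$-regular for some odd (even) $k$. A simple connected graph $G=(V,E)$ with $|V|=2^n$ is an open XOR-magic graph of power $n$ if there is a bijection $\ell:V\to(\mathbb{Z}_2)^n$ such that $\sum_{y\in N(x)}\ell(y)=0$ (the zero vector, sum in $(\mathbb{Z}_2)^n$) for every $x\in V$. It is a closed XOR-magic graph of power $n$ if there is a bijection $\ell:V\to(\mathbb{Z}_2)^n$ such that $\sum_{y\in N[x]}\ell(y)=0$ for every $x\in V$. *)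

(* Defs.v *)
From mathcomp Require Import all_boot all_order all_algebra.

Set Implicit Arguments.
Unset Strict Implicit.
Unset Printing Implicit Defensive.

Import GRing.Theory.
Local Open Scope ring_scope.

Record sgraph := SGraph {
  vertex :> finType;
  adj : rel vertex;
  adj_sym : symmetric adj;
  adj_irrefl : irreflexive adj
}.

Definition open_nbhd (G : sgraph) (x : G) : {set G} := [set y | adj x y].

Definition closed_nbhd (G : sgraph) (x : G) : {set G} := x |: open_nbhd x.

Definition connected_graph (G : sgraph) : Prop :=
  forall x y : G, connect (@adj G) x y.

Definition regular_graph (k : nat) (G : sgraph) : Prop :=
  forall x : G, #|open_nbhd x| = k.

Definition odd_regular (G : sgraph) : Prop :=
  exists2 k : nat, odd k & regular_graph k G.

Definition even_regular (G : sgraph) : Prop :=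
  exists2 k : nat, ~~ odd k & regular_graph k G.

Definition open_xor_magic (n : nat) (G : sgraph) : Prop :=
  [/\ connected_graph G,
      #|G| = (2 ^ n)%N
    & exists2 l : G -> 'rV['F_2]_n,
        bijective l & forall x : G, \sum_(y in open_nbhd x) l y = 0].

Definition closed_xor_magic (n : nat) (G : sgraph) : Prop :=
  [/\ connected_graph G,
      #|G| = (2 ^ n)%N
    & exists2 l : G -> 'rV['F_2]_n,
        bijective l & forall x : G, \sum_(y in closed_nbhd x) l y = 0].

(* Main.v *)
(** Two observations reduce the theorem to four finite graphs. The vectors of
[(Z_2)^n] sum to zero when [n > 1], so the complement of an odd-regular open
XOR-magic graph satisfies the closed condition and is even-regular; it is
connected as soon as the degree is below [2^(n-1)]. The tensor product of open
XOR-magic graphs, labelled by concatenation, is again open XOR-magic, with the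
product of the degrees; it is connected if each factor has a vertex that is
reached from every vertex by a walk of length exactly two. Powers 4, 5, 6 and 7
are given by explicit adjacency tables, and these generate all [n > 3].

The tables were found by annealing on the degrees: for disjoint affine planes
[P], [Q], exchanging edges and non-edges between [P] and [Q] preserves both the
label sums and the parity of all degrees. *)

Require Import Defs.
From Stdlib Require Import NArith.
From mathcomp Require Import all_boot all_order all_algebra.

Set Implicit Arguments.
Unset Strict Implicit.
Unset Printing Implicit Defensive.

Import GRing.Theory.
Local Open Scope ring_scope.

(** * The class of graphs used in the induction *)

(** Walks of one fixed length in two factors combine coordinatewise, so this property survives
    tensor products. Connectedness alone does not: the tensor square of an edge is disconnected. *)
Definition hub_graph (G : sgraph) : Prop :=
  exists h : G, forall x : G, exists z : G, adj x z && adj z h.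

(** The bound on [k] is what makes complements connected; every clause passes to tensor products. *)
Definition sparse_odd_open (n : nat) : Prop :=
  exists (G : sgraph) (k : nat),
    [/\ odd k, (k.*2 < 2 ^ n)%N, regular_graph k G, hub_graph G
      & exists2 l : G -> 'rV['F_2]_n,
          bijective l & forall x : G, \sum_(y in open_nbhd x) l y = 0].

Lemma card_label n (G : sgraph) (l : G -> 'rV['F_2]_n) :
  bijective l -> #|G| = (2 ^ n)%N.
Proof. by move=> /bij_eq_card->; rewrite card_mx mul1n card_Fp. Qed.

Lemma hub_connected (G : sgraph) : hub_graph G -> connected_graph G.
Proof.
move=> [h hh].
have sG : connect_sym (@adj G) by apply: sym_connect_sym; exact: adj_sym.
have ch x : connect (@adj G) x h.
  by have [z /andP[xz zh]] := hh x; apply: connect_trans (connect1 xz) (connect1 zh).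
by move=> x y; apply: connect_trans (ch x) _; rewrite sG.
Qed.

Lemma sparse_odd_open_graph n : sparse_odd_open n ->
  exists G : sgraph, odd_regular G /\ open_xor_magic n G.
Proof.
move=> [G [k [ok _ rk hG [l bl sl]]]]; exists G; split; first by exists k.
by split; [exact: hub_connected | exact: card_label bl | exists l].
Qed.

(** * Sums in characteristic two *)

Lemma natrF2 (m : nat) : m%:R = (odd m)%:R :> 'F_2.
Proof.
rewrite -[in LHS](odd_double_half m) natrD -mul2n natrM.
by rewrite (_ : 2%:R = 0 :> 'F_2) ?mul0r ?addr0 //; apply: val_inj.
Qed.

Lemma mulrnF2 (V : lmodType 'F_2) (v : V) (m : nat) : v *+ m = v *+ odd m.
Proof. by rewrite -scaler_nat natrF2 scaler_nat. Qed.

Lemma addvvF2 (V : lmodType 'F_2) (v : V) : v + v = 0.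
Proof. by rewrite -mulr2n mulrnF2. Qed.

(* Translation by the [j]-th unit vector, [j != i], pairs off the vectors
   without changing coordinate [i]. *)
Lemma sum_rowF2 n : (1 < n)%N -> \sum_(v : 'rV['F_2]_n) v = 0.
Proof.
case: n => [|[|n]] // _; apply/rowP=> i; rewrite summxE mxE.
have [j ij] : exists j : 'I_n.+2, j != i.
  by case: (eqVneq i ord0) => [->|ne]; [exists ord_max | exists ord0; rewrite eq_sym].
pose t (v : 'rV['F_2]_n.+2) := v + delta_mx 0 j.
pose P (v : 'rV['F_2]_n.+2) := v 0 j == 0.
have tt : involutive t by move=> v; rewrite /t -addrA addvvF2 addr0.
have F2c (a : 'F_2) : (a + 1 == 0) = (a != 0).
  by case: a => [[|[|m]] //= Hm]; rewrite -!val_eqE.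
rewrite (bigID P) /= [X in _ + X](reindex_inj (inv_inj tt)) /=.
set S := \sum_(v | P v) _.
apply: (@eq_trans _ _ (S + S)); last by rewrite -mulr2n -mulr_natr natrF2 mulr0.
congr (_ + _).
apply: eq_big => [v|v _]; first by rewrite /P /t !mxE !eqxx F2c negbK.
by rewrite /t !mxE eqxx eq_sym (negbTE ij) addr0.
Qed.

(** * Complements: from the open to the closed condition *)

Section Complement.
Variable G : sgraph.

Definition compl_adj (x y : G) := (x != y) && ~~ adj x y.

Lemma compl_adj_sym : symmetric compl_adj.
Proof. by move=> x y; rewrite /compl_adj eq_sym adj_sym. Qed.

Lemma compl_adj_irrefl : irreflexive compl_adj.
Proof. by move=> x; rewrite /compl_adj eqxx. Qed.

Definition compl_graph := SGraph compl_adj_sym compl_adj_irrefl.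

Lemma compl_closed_nbhd (x : G) :
  closed_nbhd (x : compl_graph) = ~: open_nbhd x :> {set G}.
Proof.
apply/setP=> y; rewrite !inE /= /compl_adj eq_sym.
by case: eqVneq => [->|]; rewrite ?adj_irrefl.
Qed.

(** The non-neighbours of a vertex in [G] include the vertex itself, hence the predecessor. *)
Lemma compl_regular k : regular_graph k G ->
  regular_graph (#|G| - k).-1 compl_graph.
Proof.
move=> rk x.
have := cardsU1 (x : compl_graph) (open_nbhd (x : compl_graph)).
rewrite -/(closed_nbhd _) inE /= /compl_adj eqxx /= add1n => e.
have := congr1 (fun A : {set G} => #|A|) (compl_closed_nbhd x).
by rewrite e (cardsCs (~: open_nbhd (x : G))) setCK rk => <-.
Qed.

(** Two open neighbourhoods cover at most [k.*2] vertices, so some [z] lies outside both; in the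
    complement each of [x] and [y] equals [z] or is adjacent to it. *)
Lemma compl_connected k : regular_graph k G -> (k.*2 < #|G|)%N ->
  connected_graph compl_graph.
Proof.
move=> rk kG x y.
have [z] : exists z, z \notin open_nbhd (x : G) :|: open_nbhd (y : G).
  apply/existsP; rewrite -negb_forall; apply: contraL kG => /forallP h.
  rewrite -leqNgt -addnn -{1}(rk x) -(rk y).
  rewrite (leq_trans _ (leq_card_setU _ _)) //.
  by rewrite subset_leq_card //; apply/subsetP.
rewrite !inE negb_or => /andP[xz yz].
have c (u : G) : ~~ adj u z -> connect compl_adj u z.
  by case: (eqVneq u z) => [-> _|uz nuz]; rewrite ?connect0 ?connect1 // /compl_adj uz.
apply: connect_trans (c x xz) _.
by rewrite (sym_connect_sym compl_adj_sym) c.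
Qed.

End Complement.

Lemma sparse_odd_open_compl n : (1 < n)%N -> sparse_odd_open n ->
  exists G : sgraph, even_regular G /\ closed_xor_magic n G.
Proof.
move=> n1 [G [k [ok k2 rk hG [l bl sl]]]]; exists (compl_graph G).
have cG := card_label bl; split.
  exists (#|G| - k).-1; last exact: compl_regular.
  have kG : (k < #|G|)%N by rewrite cG (leq_ltn_trans _ k2) // -addnn leq_addr.
  (* Since [2 ^ n] is even and [k] is odd, the difference is odd and its predecessor even. *)
  have : odd (#|G| - k) by rewrite oddB 1?ltnW // cG oddX ok; case: n n1 {l bl sl k2 cG}.
  by case: (#|G| - k)%N.
split => //; first by apply: compl_connected rk _; rewrite cG.
exists l => // x; rewrite compl_closed_nbhd.
have := sum_rowF2 n1; rewrite (reindex l) /=; last exact: onW_bij.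
(* The zero sum of all labels splits into the part over the open neighbourhood, which vanishes, and
   the part over its complement. *)
rewrite (bigID (mem (open_nbhd (x : G)))) /= sl add0r => sC.
by rewrite -[RHS]sC; apply: eq_bigl => y; rewrite inE.
Qed.

(** * Tensor products and addition of powers *)

Section Tensor.
Variables G H : sgraph.

Definition tensor_adj (x y : G * H) := adj x.1 y.1 && adj x.2 y.2.

Lemma tensor_adj_sym : symmetric tensor_adj.
Proof. by move=> x y; rewrite /tensor_adj adj_sym [adj x.2 _]adj_sym. Qed.

Lemma tensor_adj_irrefl : irreflexive tensor_adj.
Proof. by move=> x; rewrite /tensor_adj adj_irrefl. Qed.

Definition tensor_graph := SGraph tensor_adj_sym tensor_adj_irrefl.

Lemma tensor_open_nbhd (x : G * H) :
  open_nbhd (x : tensor_graph) = setX (open_nbhd x.1) (open_nbhd x.2).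
Proof. by apply/setP=> y; rewrite !inE. Qed.

Lemma tensor_regular k m : regular_graph k G -> regular_graph m H ->
  regular_graph (k * m) tensor_graph.
Proof. by move=> rk rm x; rewrite tensor_open_nbhd cardsX rk rm. Qed.

Lemma tensor_hub : hub_graph G -> hub_graph H -> hub_graph tensor_graph.
Proof.
move=> [g hg] [h hh]; exists (g, h) => -[x y].
have [z /andP[xz zg]] := hg x; have [w /andP[yw wh]] := hh y.
by exists (z, w); rewrite /= /tensor_adj /= xz zg yw wh.
Qed.

End Tensor.

Lemma sparse_odd_open_add m n :
  sparse_odd_open m -> sparse_odd_open n -> sparse_odd_open (m + n).
Proof.
move=> [G [k [ok k2 rk hG [l bl sl]]]] [H [k' [ok' k2' rk' hH [l' bl' sl']]]].
exists (tensor_graph G H), (k * k')%N; split.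
- by rewrite oddM ok ok'.
(* Multiply [k.*2 < 2 ^ m] by [k' <= k'.*2 < 2 ^ n]. *)
- rewrite doubleMl expnD ltn_mul // (leq_ltn_trans _ k2') //.
  by rewrite -addnn leq_addr.
- exact: tensor_regular.
- exact: tensor_hub.
exists (fun x : G * H => row_mx (l x.1) (l' x.2)).
  have [f lf fl] := bl; have [f' lf' fl'] := bl'.
  exists (fun v => (f (lsubmx v), f' (rsubmx v))).
    by case=> x y; rewrite row_mxKl row_mxKr lf lf'.
  by move=> v; rewrite fl fl' hsubmxK.
move=> x; rewrite tensor_open_nbhd.
rewrite -[LHS]hsubmxK -[RHS]hsubmxK; congr row_mx; rewrite linear_sum linear0 /=.
  under eq_bigr do rewrite row_mxKl; under eq_bigl do rewrite inE.
  (* In the left block each [l y] is repeated once per neighbour of [x.2], giving a multiple of a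
     zero sum; in the right block every inner sum is already zero. *)
  rewrite -(pair_big (mem (open_nbhd x.1)) (mem (open_nbhd x.2)) (fun y _ => l y)) /=.
  by under eq_bigr do rewrite sumr_const; rewrite sumrMnl sl mul0rn.
under eq_bigr do rewrite row_mxKr; under eq_bigl do rewrite inE.
rewrite -(pair_big (mem (open_nbhd x.1)) (mem (open_nbhd x.2)) (fun _ => l')) /=.
by rewrite big1.
Qed.

Lemma sparse_odd_open_ge4 :
  sparse_odd_open 4 -> sparse_odd_open 5 -> sparse_odd_open 6 ->
  sparse_odd_open 7 -> forall n, (3 < n)%N -> sparse_odd_open n.
Proof.
move=> h4 h5 h6 h7; elim/ltn_ind=> n IH n3.
have [n8|n8] := ltnP n 8; last first.
  (* Write [n] as 4 + (n - 4); both summands are at least 4 once [n] is at least 8. *)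
  rewrite -(subnKC (leq_trans (isT : 4 <= 8)%N n8)).
  apply: sparse_odd_open_add => //; apply: IH.
    by rewrite ltn_subrL (leq_trans _ n8).
  by rewrite ltn_subRL (leq_trans _ n8).
by case: n n3 n8 {IH} => [|[|[|[|[|[|[|[|]]]]]]]].
Qed.

(** * Boolean verification of explicit tables *)

(** Only numbers, lists and booleans occur, so the test can be evaluated directly. Vertex 0 serves
    as hub, and label sums are tested coordinatewise by parity. *)
Definition table_check (n k : nat) (e b : rel nat) : bool :=
  let V := iota 0 (2 ^ n) in
  [&& odd k, (k.*2 < 2 ^ n)%N,
    all (fun x => ~~ e x x && all (fun y => e x y == e y x) V) V,
    all (fun x => let N := filter (e x) V in
      (size N == k) && all (fun i => ~~ odd (count (b^~ i) N)) (iota 0 n)) V,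
    all (fun x => has (fun z => e x z && e z 0) V) V
  & uniq [seq [seq b x i | i <- iota 0 n] | x <- V]].

Lemma table_sparse_odd_open n k (e b : rel nat) :
  table_check n k e b -> sparse_odd_open n.
Proof.
rewrite /table_check; set V := iota 0 _.
move=> /and5P[ok k2 /allP es /allP eN /andP[/allP eh ub]].
have inV (x : 'I_(2 ^ n)) : (x : nat) \in V by rewrite mem_iota ltn_ord.
pose a (x y : 'I_(2 ^ n)) := e x y.
have aS : symmetric a.
  by move=> x y; have /andP[_ /allP/(_ _ (inV y))/eqP] := es _ (inV x).
have aI : irreflexive a.
  by move=> x; have /andP[/negbTE] := es _ (inV x).
pose G := SGraph aS aI.
(* Stated for a general [T] because it serves twice: in [nat] with the constant 1 for degrees, and
   in ['F_2] for label coordinates. *)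
have sN (T : nmodType) (F : nat -> T) (x : G) :
    \sum_(y in open_nbhd x) F (y : 'I_(2 ^ n)) =
    \sum_(y <- filter (e (x : 'I_(2 ^ n))) V) F y.
  rewrite big_filter /V -[X in iota _ X]subn0 -/(index_iota 0 _) big_mkord.
  by apply: eq_bigl => y; rewrite inE.
exists G, k; split => //.
- move=> x; have /andP[/eqP <- _] := eN _ (inV x).
  by rewrite -sum1_card -sum1_size; exact: (sN nat (fun=> 1%N)).
- have p0 : (0 < 2 ^ n)%N by rewrite expn_gt0.
  exists (Ordinal p0 : G) => x; have /hasP[z zV xz] := eh _ (inV x).
  have zlt : (z < 2 ^ n)%N by rewrite mem_iota in zV.
  by exists (Ordinal zlt).
pose l (x : G) : 'rV['F_2]_n := \row_i (b (x : 'I_(2 ^ n)) i)%:R.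
exists l.
  (* Both sides have [2 ^ n] elements, so injectivity suffices; it comes from the distinctness of
     the bit rows. *)
  apply: inj_card_bij; last by rewrite card_mx mul1n card_Fp // card_ord.
  move=> x y /rowP lxy; apply: val_inj.
  have sV (z : 'I_(2 ^ n)) : nth 0%N V z = z by rewrite nth_iota.
  have xV (z : 'I_(2 ^ n)) : (z < size V)%N by rewrite size_iota.
  have := uniqP [::] ub x y; rewrite !inE !size_map; apply => //.
  rewrite !(nth_map 0%N) // !sV; apply/eq_in_map => i.
  rewrite mem_iota => /andP[_ ilt]; have := lxy (Ordinal ilt).
  by rewrite !mxE /=; do 2!case: (b _ _) => //; move/(congr1 val).
move=> x; apply/rowP=> i; rewrite summxE mxE.
have /andP[_ /allP/(_ (i : nat))] := eN _ (inV x).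
rewrite mem_iota ltn_ord => /(_ isT)/negbTE odd0.
under eq_bigr do rewrite mxE.
(* Coordinate [i] of the sum is the parity of the number of neighbours whose bit [i] is set. *)
rewrite (sN _ (fun y => (b y i)%:R)) -natr_sum natrF2.
set N := filter _ _ in odd0 *.
rewrite (_ : (\sum_(y <- N) b y i)%N = count (b^~ i) N) ?odd0 //.
by rewrite -sum1_count [RHS]big_mkcond; apply: eq_bigr => y _; case: (b y i).
Qed.

(* Row [x] of a table is the neighbourhood of vertex [x], as a bit mask; vertex
   [x] is labelled by its binary digits. *)
Definition table_adj (t : seq N) : rel nat :=
  fun x y => N.testbit (nth N0 t x) (N.of_nat y).

Definition binary_digit : rel nat := fun x i => N.testbit (N.of_nat x) (N.of_nat i).

Definition table4 : seq N := [::
  0x3c68; 0xc534; 0x03f2; 0x5c91; 0x3c0e; 0x0ac7; 0xe825; 0x872c; 0x7886;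
  0xf0a4; 0xc09b; 0x1179; 0x2b19; 0x9351; 0x874a; 0x66c2]%num.

Definition table5 : seq N := [::
  0x54da0eb2; 0xcbc1a259; 0xeddb0c08; 0x3de08696; 0x384ca2eb; 0xb3023bd1;
  0x1cbc85b2; 0x56a58479; 0x64b6bc60; 0xc339c03b; 0x846ae1cd; 0x417be125;
  0xeedb4120; 0x06ee4d32; 0x9b3d3e00; 0x601e0fda; 0x39725a86; 0x22e1bd25;
  0x6fa0e1d0; 0x8070fe55; 0x0f09db45; 0x300f6fc8; 0x308b3c1f; 0x8a4631cf;
  0xda154a2e; 0xd19672a2; 0xb81435cd; 0x9595505e; 0x4f6140f9; 0xc467913c;
  0xb3049b87; 0x6f885626]%num.

Definition table6 : seq N := [::
  0x73625b9e2784e1a4; 0x918b1d6ece4259e8; 0x851a99309ddabb61;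
  0xe61ee0e72eab0a42; 0xfef7212b999a04a0; 0xd72498850457eb57;
  0xc5ce1ad2db1904ae; 0x1967c40773ce6153; 0x20509711bcfadaa7;
  0xede68e40ea2d852c; 0x5f14bbb408f4da50; 0x2298cfa1939ec52e;
  0xbaad4ec51e09e506; 0x909c67ecc653d0a5; 0x618d3aba5284bda3;
  0x31d4d1d3d4017f25; 0x6407b5bca32eb268; 0xbab02a0e29ad29be;
  0xcf1b2b110f334ea1; 0x3327f25e04131bdc; 0x5824edbcd0cc2d74;
  0x068cc6fdfb870708; 0x6ff6c819f09025a6; 0x4d3565189a724d9d;
  0x2fa9457b702708d5; 0x2566d0d268a57acb; 0x7e21429f780cb12f;
  0x8c0498fe96a6175e; 0xacd175204df0d9d4; 0xd8ff2e0c47630389;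
  0x7f0ea5183770e2c2; 0xec1079e608f1ab56; 0xd4b3af86056499b8;
  0x1312f6f18f0ac0db; 0x84a752e1ac3b34ab; 0xabe9a0606dfb6013;
  0x715346024ffdc545; 0x1396b54e99316c1e; 0xb55b1aae8b28b24a;
  0xd03946478e31fc69; 0x40e9ee21d195ad17; 0x8cec41d7242e7f41;
  0xa950f1b371b13b82; 0x5d786141a8565e67; 0xebc984669a09c567;
  0xe5914d2bf09f6418; 0x020daf9697f8b889; 0x9a0a552b4a798fac;
  0x53b871dd358d5092; 0x1fd88077624d02df; 0x0af042246af9f6f8;
  0x97a3dbc86124784e; 0x62472cf3b0c6ad1c; 0xce4d0b8d27da12b1;
  0xdfb61f58324083d1; 0x984f332d3162fa52; 0x084b3c7a43ccc6e7;
  0x1c7fd02a456e1c39; 0x226a2a45dfe5067c; 0x23e69e08fdd61690;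
  0x62cb88f3641ab4b3; 0xdc103458d74bdb19; 0xb0713991e4d54679;
  0x60e8b6cdb806327e]%num.

Definition table7 : seq N := [::
  0x8d2996d28e5bb64c387b795dd4709830; 0xef8ef764aa934d98a89bc5b3398a1600;
  0x4d14d7d3a2cde3ca3a16bc855a6b10b8; 0xc0dc2ea37896626fdd98d673520d5e04;
  0xa998c2e829d5b818dafa5c2c5e49b1e5; 0xad0f72b1b491f4b56a44387760726d15;
  0xd1ded2f24137b33204403bfc176b7590; 0x41bf6c28e518a7f4c462fe3a6e4aa254;
  0x169d6353a55d0507fa33b97594a53870; 0x45ccd5e763b29ccab9077c4aec65208a;
  0x4d223cbd56a5ccc0967df978d643206a; 0x14e34e39e76d4d449e9fb380a067d129;
  0xc96d48f2bc1422fd6e6203d44cda495f; 0x58d61986cd175a9231ea6f35095787f0;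
  0x5b767a7115a76dbb5dba192232089868; 0xec918e6135ddf1bef77081a811276891;
  0x9cc2aaec038b52ef55de2d114318af5c; 0x54d54a017763231fa6896d961974bce6;
  0xa14372d2c2faed98ec16d1d14b7aab08; 0x06a9359a88e5de91fbd609f0d09550de;
  0x67e286f2a95638edebc885a1a9cf3021; 0x3e1582bceac0ec89be92d1177c868b65;
  0x3315e1349a5224b33a8bf90c3b163ef5; 0xde2ee2885b668f4baadfa1d876381102;
  0x5a7940ea1f666b1c9ca5be7cc857a042; 0xc87a4d8912f89924b57f4cbe2cc544dc;
  0x794034fe596234c58ce5fbf132a017d1; 0xec0009418cf79ded13196b2df3763296;
  0xd5c4283d6ca7d016f418eda08ceac55f; 0xbc87da91b54c399ef640e4d88ef04aa2;
  0x39a6d296a45b520b1c9dc1da89ad16bd; 0x8eda3f173b25fd78e1aa461279180f01;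
  0xf11c110fe65b9b7c9e326c360c35212f; 0xc87282a7e37b474cc68fbfa9c22242aa;
  0x42b31adc43035ff6739257e10b623175; 0xe311aac3419ed3c76a2f36e26bc086d1;
  0xc4fdea8e5044dcd165224081e7af35eb; 0x5932b1d1e86b30560dca704f1f18e5fa;
  0xa7c83da27edaac5b305c50ac658c1769; 0x0e5cc2a7d9bc41b61d450d5e769e9846;
  0x45aca16e0c721175e10d86865cfffd43; 0xbb7c7ae05235faeee0ec390e8d0038c8;
  0xa9d8ff305a27b46c125a318fb313229e; 0x0e98f40692615bb7851752831f4b67f5;
  0x26e9123aa8af574146c86e6e05644ffd; 0x12640eb8c4aa48cbd9a5d62b3dc32fe5;
  0x82b275646c303d3133a4b875fe66269b; 0xa633ca2a0694fe54d3db610275f48d8e;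
  0x7b30bb0880a1d2f76ffca98a4fc20f03; 0x8cad0f63147cca268b408c3f82ed7b97;
  0x779a30937c412953f5e96bca478d0e24; 0x290ae11bf3e60ee000f5976adad36c1b;
  0x14ca9f56721cb19e44698c455aadcd1f; 0x76facb5ca3cb050e7c9d62198700f591;
  0xe04b562e417475eb291f96e02699b4f1; 0x1bdba9337410658c6c2df226c5fb681a;
  0x6b4e8f05a8d93aafea47e9b48a19e208; 0x4bc5fe504e08f29bad03d40f28fa9d34;
  0x3a1f507e899a3846c2b518b37727dcc8; 0x857c97deb819440543e320a945fc5b3f;
  0xb70845c53f07991a6024e4c57b69ef1d; 0x331f108f898fc82413e5435cb2feb327;
  0xb7fb073c16245c401db5b31eb01dd1b8; 0xd34559a63cf1aa100706ab03b7be8f9a;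
  0x0847c765c7eee6e40b4579584cfb5128; 0x53958d991dadc48417772aec70c3e34c;
  0x8d33f46e0024442b2db38faf3f1399a9; 0x3880bd0df8ecbc4413f02643e9b7d21f;
  0x03842163fefbee009215c9f5b14ef0f2; 0xe4ebe74d13cb6f05214b4f858a51d0e8;
  0x05f8ad3bf0d06509444db77f8c911e8d; 0xc7653847e52b830303d92a9c2c7df6a6;
  0x64d8e82e9ad9aee010f4598fab86c9c6; 0xdae03ed61f6765b1830b9a0f418b30cd;
  0xa85430decf44137f48e8d4568cec4fa3; 0x10fe351182e6d138f50eea55abbc6e12;
  0xbef5c24956008c085751df3dfe19a271; 0x303a6808ed9dc37987d4c660a576d0fd;
  0xa226061dc1c1aa776ac3ba9ed12dec2e; 0xec0a5e889e86799bb21386599aac86f5;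
  0xe731a520b0d063b2b9251e27d80bed77; 0x9966347d54688ab13428356f5dd7624b;
  0xb0eca0f07528ae0f705a9698b998fd5c; 0xc9e0af5d6b7621bb2f3230eb62058985;
  0x0a83c6cfb74921508dd2c3cb4a54b3fb; 0x0c84d3daee8e0a9fc04b7fa29f8e4e40;
  0xbd300b012a9b4f79816e09736ffe8915; 0x4075d01bfb61e97ba529b0c81a2dc63e;
  0x89e69fcfb89c66a33468008ea593ebd0; 0xede8fba400f89f3152388e4783e70e07;
  0x742ff170d836b693d286e1417902fda1; 0x56d98253b5e8a71abf0455e09df8301b;
  0x31652bcf0d97937ad89e0ed0a7c2d428; 0x5e3b28c189fd20d899bc5063f0329bbe;
  0x1c36a6da84ae74d902dc66ff14a62ec8; 0x6e8c14056db1edd92d2938a3687c39a7;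
  0x433f4ab8b9da58fb318e00abba02cf2c; 0x3f81495459b007d4acde99dbc51c334d;
  0x1753df52931a47adfd704997d4612602; 0x673d66c151baf56e6c69b11517a90c90;
  0x2ea159a74cae4e424ebc3424f47c5d65; 0xe24b5fd106070155c4c2f7c21571defa;
  0x428d39ae7d3e16b51e32432c0d15d357; 0xa905d57973348602b80422fe67bd367d;
  0xfa1bdcf61769087bd9bb45618a482306; 0x5700002d5b78d2214b73b69ee0b7c97f;
  0x5fd4b9acc11bca6f5b526c4086188e8f; 0xbc5315773348a3ca83b3a65cba03fc88;
  0x34a26df487a28e8cae555e65e40c6667; 0x1b7b1448760f2ffc028d4f7894cd45aa;
  0xb98591bf06b0b1259668ce9063c65bf6; 0xb33145844fbd116f0bb98dba60f18257;
  0x75cee9ff3c9110a7e6c2901c216e99a1; 0xdbf539256512e82565fcc026e2956ce2;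
  0x2e5b44c9d5a65c93af02239170e273ee; 0xb4652169ae04a9607dfe1fd1838813fb;
  0x5286ad0d68c13d466ca5cebf8362e1dc; 0xe3cab01977cf7ae44823f33643985c81;
  0xd02f2c241b8e1fe1cbf036d297177a48; 0x8a3354528b3c1b7a42b65d54f01babda;
  0xb023e68f134b00d6fb8d0769545456f7; 0xb8b6a77fa8115292f7a5facc81f84102;
  0xd00d1e1eee6191e4583699d0b8bb8f27; 0x82866d92e37a960d078b0ea2efa1f437;
  0x675bff067c463a0af4b5222175e36940; 0xd32dd9ba9645f528756d96496c748032;
  0xb4730769ae8983a28365013f1f92f6ce; 0x6feac9a0034fd6a4d842c65bba85907b]%num.

(** * The base cases and the conclusion *)

(** In this and the next three cases the degree is [2 ^ n.-1 - 1], the largest that the bound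
    [k.*2 < 2 ^ n] permits. *)
Lemma sparse_odd_open4 : sparse_odd_open 4.
Proof.
by apply: (@table_sparse_odd_open 4 7 (table_adj table4) binary_digit); vm_compute.
Qed.

Lemma sparse_odd_open5 : sparse_odd_open 5.
Proof.
by apply: (@table_sparse_odd_open 5 15 (table_adj table5) binary_digit); vm_compute.
Qed.

Lemma sparse_odd_open6 : sparse_odd_open 6.
Proof.
by apply: (@table_sparse_odd_open 6 31 (table_adj table6) binary_digit); vm_compute.
Qed.

Lemma sparse_odd_open7 : sparse_odd_open 7.
Proof.
by apply: (@table_sparse_odd_open 7 63 (table_adj table7) binary_digit); vm_compute.
Qed.

Theorem theorem2 (n : nat) (hn : (3 < n)%N) :
  (exists G : sgraph, even_regular G /\ closed_xor_magic n G) /\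
  (exists G : sgraph, odd_regular G /\ open_xor_magic n G).
Proof.
have so : sparse_odd_open n.
  apply: sparse_odd_open_ge4 hn; [exact: sparse_odd_open4 | exact: sparse_odd_open5
    | exact: sparse_odd_open6 | exact: sparse_odd_open7].
split; last exact: sparse_odd_open_graph.
by apply: sparse_odd_open_compl so; apply: leq_trans hn.
Qed.
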